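(* Let $n\in\mathbb{N}$, let $\pi\in S_n$ be a fixed permutation, let $v\in S_d$ be a pattern, and let $1<\ell<d$ be an integer. Writing $N(u,\sigma)$ for the number of occurrences of a pattern $u$ in a permutation $\sigma$, we have $$N(v,\pi)\leq \prod_{w\in C_\ell(v)} N(w,\pi)^{\,N(w,v)/\binom{d-1}{\ell-1}}.$$
   Context: $S_m$ denotes the set of permutations of $[m]=\{1,\dots,m\}$, viewed as sequences. A pattern of length $k$ is a permutation $u\in S_k$. A sequence of $k$ distinct numbers is order-isomorphic to $u\in S_k$ if its entries are in the same relative order as $u_1,\dots,u_k$. For a permutation $\sigma\in S_m$, an occurrence of $u\in S_k$ in $\sigma$ is a $k$-subset $\{j_1<\dots<j_k\}\subseteq[m]$ such that $\sigma_{j_1}\cdots\sigma_{j_k}$ is order-isomorphic to $u$; $N(u,\sigma)$ is the number of such $k$-subsets (it is $0$ if $k>m$). $C_\ell(v)$ denotes the set of patterns $w\in S_\ell$ occurring in $v$. *)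

(* Defs.v *)
From HB Require Import structures.
From mathcomp Require Import all_boot all_order all_fingroup all_algebra.
From mathcomp Require Import reals exp.

Set Implicit Arguments.
Unset Strict Implicit.
Unset Printing Implicit Defensive.

(* 'S_m is the group of permutations of 'I_m = {0, ..., m-1}: positions and
   values are numbered from 0 rather than from 1. *)

Definition order_isomorphic (k : nat) (s : seq nat) (u : 'S_k) : bool :=
  (size s == k) &&
  [forall a : 'I_k, forall b : 'I_k, (nth 0 s a < nth 0 s b) == (u a < u b)].

(* [enum J] lists the elements of J in increasing order, so this is the
   sequence sigma_{j_1} ... sigma_{j_k} for J = {j_1 < ... < j_k}. *)
Definition subword (m : nat) (sigma : 'S_m) (J : {set 'I_m}) : seq nat :=
  [seq val (sigma j) | j <- enum J].

Definition occurrences (k m : nat) (u : 'S_k) (sigma : 'S_m) :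
    {set {set 'I_m}} :=
  [set J : {set 'I_m} | (#|J| == k) && order_isomorphic (subword sigma J) u].

Definition Nocc (k m : nat) (u : 'S_k) (sigma : 'S_m) : nat :=
  #|occurrences u sigma|.

Definition patterns_in (l d : nat) (v : 'S_d) : {set 'S_l} :=
  [set w : 'S_l | occurrences w v != set0].

(* Main.v *)
Require Import Defs.
From HB Require Import structures.
From mathcomp Require Import all_boot all_order all_fingroup all_algebra.
From mathcomp Require Import reals exp.

(** Encode an occurrence of [v] in [pi] by the [d]-tuple of its positions in
    increasing order.  Keeping only the coordinates in an [l]-subset [S] of
    ['I_d] yields an occurrence of the pattern that [v] induces on [S], and every
    coordinate lies in ['C(d - 1, l - 1)] such subsets.  Shearer's inequality
    therefore bounds [Nocc v pi ^ 'C(d - 1, l - 1)] by the product over all [S]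
    of the numbers of occurrences of the induced patterns, in which the pattern
    [w] appears [Nocc w v] times.  Shearer's inequality is proved by fixing one
    coordinate at a time, summing the fibres with Hoelder's inequality, which in
    turn comes from AM-GM. *)

Set Implicit Arguments.
Unset Strict Implicit.
Unset Printing Implicit Defensive.

Import Order.TTheory GRing.Theory Num.Theory.

Local Open Scope ring_scope.

(** * Hoelder's inequality from AM-GM *)

(** Divide each [a k] by its total [s k]: AM-GM bounds [b x], up to the factor [D], by the mean
    [mu x] of the quotients, and these means sum to 1. *)
Lemma hoelder_geometric_mean (R : realType) (X K : finType) (A : {pred K})
    (c : R) (a : K -> X -> R) (b : X -> R) :
  (0 < #|A|)%N -> 0 <= c -> (forall k x, 0 <= a k x) ->
  (forall x, 0 <= b x) ->
  (forall x, b x ^+ #|A| <= c * \prod_(k in A) a k x) ->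
  (\sum_x b x) ^+ #|A| <= c * \prod_(k in A) \sum_x a k x.
Proof.
set t := #|A| => t0 c0 a0 b0 hb.
pose s k := \sum_x a k x.
have s0 k : 0 <= s k by apply: sumr_ge0.
have M0 : 0 <= c * \prod_(k in A) s k by rewrite mulr_ge0 // prodr_ge0.
(* If the bound vanishes, dividing by [s k] may be impossible, but then every [b x] is 0. *)
case: (eqVneq (c * \prod_(k in A) s k) 0) => [Mz|Mnz].
  rewrite big1 ?expr0n ?eqn0Ngt ?t0 // => x _.
  suff cz : c * \prod_(k in A) a k x = 0.
    apply/eqP; have := hb x; rewrite cz => le0.
    have : b x ^+ t == 0 by rewrite eq_le le0 exprn_ge0.
    by rewrite expf_eq0 t0.
  move/eqP: Mz; rewrite mulf_eq0 => /orP[/eqP->|]; first by rewrite mul0r.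
  case/prodf_eq0 => k kA /eqP sk0.
  rewrite (bigD1 k) //= (_ : a k x = 0) ?mul0r ?mulr0 //.
  by have /psumr_eq0P : s k = 0 by []; apply.
pose D := (c * \prod_(k in A) s k) `^ t%:R^-1.
have tR : t%:R != 0 :> R by rewrite pnatr_eq0 -lt0n.
have Dt : D ^+ t = c * \prod_(k in A) s k.
  by rewrite -powR_mulrn ?powR_ge0 // -powRrM mulVf // powRr1.
have sn0 k : k \in A -> s k != 0.
  move=> kA; move: Mnz; rewrite mulf_eq0 negb_or => /andP[_ /prodf_neq0].
  exact.
pose mu x := (\sum_(k in A) a k x / s k) / t%:R.
have mu0 x : 0 <= mu x.
  by rewrite divr_ge0 // sumr_ge0 // => k _; rewrite divr_ge0.
have bmu x : b x <= D * mu x.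
  rewrite -(@ler_pXn2r _ t) ?nnegrE ?(mulr_ge0 (powR_ge0 _ _) (mu0 x)) //.
  apply: (le_trans (hb x)); rewrite exprMn Dt.
  have -> : c * \prod_(k in A) a k x =
      c * \prod_(k in A) s k * \prod_(k in A) (a k x / s k).
    rewrite -mulrA -big_split /=; congr (_ * _); apply: eq_bigr => k kA.
    by rewrite mulrCA divff ?mulr1 ?sn0.
  apply: ler_wpM2l => //.
  by apply: (leif_AGM (E := fun k => a k x / s k)) => k _; rewrite divr_ge0.
have mu1 : \sum_x mu x = 1.
  rewrite -mulr_suml exchange_big /= (eq_bigr (fun=> 1)) => [|k kA].
    by rewrite sumr_const divff.
  by rewrite -mulr_suml divff ?sn0.
rewrite -[X in _ <= X]Dt lerXn2r ?nnegrE ?powR_ge0 ?sumr_ge0 //.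
apply: (le_trans (ler_sum _ (fun x _ => bmu x))).
by rewrite -mulr_sumr mu1 mulr1.
Qed.

(** * Shearer's inequality *)

(** Coordinates outside [S] are overwritten by [x0] instead of dropped, so that all projections
    share one type. *)
Definition coord_proj (I T : finType) (x0 : T) (S : {set I})
    (f : {ffun I -> T}) : {ffun I -> T} :=
  [ffun i => if i \in S then f i else x0].

(* The induction is on the set [D] of coordinates on which [F] is not yet
   constant; fixing one more value shrinks [D] but leaves the sets [S k] alone. *)
Lemma shearer_free_coords (R : realType) (I T K : finType) (x0 : T)
    (Q : {set K}) (S : K -> {set I}) (t : nat) (D : {set I})
    (F : {set {ffun I -> T}}) :
  (0 < t)%N ->
  {in D, forall i, #|[set k in Q | i \in S k]| = t} ->
  {in F &, forall (f g : {ffun I -> T}) i, i \notin D -> f i = g i} ->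
  #|F|%:R ^+ t <= \prod_(k in Q) #|coord_proj x0 (S k) @: F|%:R :> R.
Proof.
move=> t0; elim: {D}#|D| {-2}D (erefl #|D|) F => [|m IH] D cD F cov agree.
  (* With [D] empty, [F] has at most one element; for empty [F] the left side is 0 because [t] is
     positive. *)
  have [->|[f fF]] := set_0Vmem F.
    by rewrite cards0 expr0n eqn0Ngt t0 prodr_ge0.
  have FE : F = [set f].
    apply/setP => g; rewrite inE; apply/idP/eqP => [gF|->//].
    by apply/ffunP => i; apply: agree => //; rewrite (cards0_eq cD) inE.
  rewrite FE cards1 expr1n big1 // => k _.
  by rewrite imset_set1 cards1.
have /card_gt0P [i iD] : (0 < #|D|)%N by rewrite cD.
pose Fx x := [set f in F | f i == x].
pose A := [set k in Q | i \in S k].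
have cA : #|A| = t by apply: cov.
have sF : #|F| = (\sum_x #|Fx x|)%N.
  rewrite -sum1_card (partition_big (fun f : {ffun I -> T} => f i) predT) //=.
  apply: eq_bigr => x _; rewrite -sum1_card.
  by apply: eq_bigl => f; rewrite !inE.
have sub x k : coord_proj x0 (S k) @: Fx x \subset coord_proj x0 (S k) @: F.
  by apply: imsetS; apply/subsetP => f; rewrite inE => /andP[].
(* The factors whose [S k] misses [i] form the constant [c]; the other [t] factors are split over
   the fibres [Fx x]. *)
rewrite (bigID (fun k => i \in S k)) /= mulrC.
set c := \prod_(k in Q | i \notin S k) _.
have c0 : 0 <= c by apply: prodr_ge0.
apply: (@le_trans _ _
  (c * \prod_(k in A) \sum_x #|coord_proj x0 (S k) @: Fx x|%:R)); last first.
  apply: ler_wpM2l => //.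
  rewrite (eq_bigl (fun k => (k \in Q) && (i \in S k))); last first.
    by move=> k; rewrite inE.
  (* Since [S k] contains [i], the projection keeps the value at [i], so distinct fibres have
     disjoint projections. *)
  apply: ler_prod => k /andP[_ ik]; rewrite sumr_ge0 //= -natr_sum ler_nat.
  rewrite -[X in (_ <= X)%N]sum1_card.
  rewrite (partition_big (fun f : {ffun I -> T} => f i) predT) //=.
  apply: leq_sum => x _; rewrite -sum1_card big_mkcond [X in (_ <= X)%N]big_mkcond /=.
  apply: leq_sum => g _.
  case: ifP => // /imsetP [f]; rewrite inE => /andP[fF /eqP fx] ->.
  by rewrite imset_f //= ffunE ik fx eqxx.
rewrite sF natr_sum -{1}cA; apply: hoelder_geometric_mean => //.
  by rewrite cA.
move=> x; rewrite cA.
have := IH (D :\ i) _ (Fx x); rewrite (cardsD1 i D) iD in cD.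
case: cD => cD /(_ cD) /= IHx; apply: le_trans (IHx _ _) _.
- by move=> j /setD1P [_ jD]; apply: cov.
- move=> f g; rewrite !inE => /andP[fF /eqP fx] /andP[gF /eqP gx] j.
  by rewrite !inE negb_and negbK => /orP[/eqP->|jD]; [rewrite fx gx | apply: agree].
- rewrite (bigID (fun k => i \in S k)) /= mulrC.
  rewrite [X in _ * X <= _](eq_bigl (fun k => k \in A)); last by move=> k; rewrite !inE.
  apply: ler_wpM2r; first exact: prodr_ge0.
  by apply: ler_prod => k _; rewrite ler0n ler_nat subset_leq_card.
Qed.

Lemma shearer (R : realType) (I T K : finType) (x0 : T)
    (Q : {set K}) (S : K -> {set I}) (t : nat) (F : {set {ffun I -> T}}) :
  (0 < t)%N -> (forall i, #|[set k in Q | i \in S k]| = t) ->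
  #|F|%:R ^+ t <= \prod_(k in Q) #|coord_proj x0 (S k) @: F|%:R :> R.
Proof.
move=> t0 cov; apply: (@shearer_free_coords _ _ _ _ _ _ _ _ [set: I]) => //.
by move=> f g _ _ i; rewrite inE.
Qed.

(** Removing [i] gives a bijection onto the subsets of size [l - 1] of the remaining elements. *)
Lemma card_draws_mem (I : finType) (l : nat) (i : I) :
  (0 < l)%N ->
  #|[set S : {set I} | (#|S| == l) && (i \in S)]| = 'C(#|I| - 1, l - 1).
Proof.
move=> l0; rewrite -[in RHS](cardsT I) (cardsD1 i [set: I]) inE add1n.
rewrite [in RHS]subn1 /= -cards_draws.
set B := [set A : {set I} | _ & #|A| == (l - 1)%N].
rewrite -(@card_in_imset _ _ (fun A => i |: A) B).
  apply: eq_card => S; rewrite inE; apply/andP/imsetP.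
    case=> /eqP cS iS; exists (S :\ i); last by rewrite setD1K.
    by rewrite inE setSD ?subsetT //= -cS (cardsD1 i S) iS add1n subn1.
  case=> A; rewrite inE => /andP[Ai /eqP cA] ->.
  have iA : i \notin A.
    by apply/negP => /(subsetP Ai); rewrite !inE eqxx.
  by rewrite cardsU1 iA cA add1n subn1 prednK // eqxx setU11.
move=> A A'; rewrite !inE => /andP[Ai _] /andP[A'i _] E.
have NA (C : {set I}) : C \subset [set: I] :\ i -> (i |: C) :\ i = C.
  move=> Ci; apply: setU1K; apply/negP => /(subsetP Ci).
  by rewrite !inE eqxx.
by rewrite -(NA A) // E NA.
Qed.

(** * Increasing enumerations, and the pattern induced on a set of positions *)

Lemma sorted_enum_set (n : nat) (J : {set 'I_n}) :
  sorted (fun i j : 'I_n => (i < j)%N) (enum J).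
Proof.
apply: sorted_filter; first by move=> ? ? ?; apply: ltn_trans.
rewrite -enumT -(@sorted_map _ _ val ltn) val_enum_ord.
exact: iota_ltn_sorted.
Qed.

Lemma enum_imset_mono (m n : nat) (h : 'I_m -> 'I_n) (S : {set 'I_m}) :
  {homo h : i j / (i < j)%N} -> enum (h @: S) = [seq h i | i <- enum S].
Proof.
move=> hh; apply: (@irr_sorted_eq _ (fun i j : 'I_n => (i < j)%N)).
- by move=> ? ? ?; apply: ltn_trans.
- by move=> ?; rewrite ltnn.
- exact: sorted_enum_set.
- by apply: (homo_sorted hh); apply: sorted_enum_set.
- move=> x; rewrite mem_enum; apply/imsetP/mapP => -[i iS ->]; exists i => //.
    by rewrite mem_enum.
  by rewrite mem_enum in iS.
Qed.

(** Each value below [u a] is attained exactly once; hence comparisons alone determine a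
    permutation. *)
Lemma card_perm_lt (k : nat) (u : 'S_k) (a : 'I_k) :
  #|[set b | (u b < u a)%N]| = u a.
Proof.
rewrite -(card_imset _ (@perm_inj _ u)).
have -> : u @: [set b | (u b < u a)%N] = [set c : 'I_k | (c < u a)%N].
  apply/setP => c; rewrite inE; apply/imsetP/idP => [[b]|ca].
    by rewrite inE => h ->.
  by exists (u^-1%g c); rewrite ?inE ?permKV.
rewrite -sum1dep_card -(big_ord_widen k (fun=> 1%N)); last exact: ltnW.
by rewrite sum_nat_const card_ord muln1.
Qed.

Lemma order_isomorphic_inj (k : nat) (s : seq nat) (u u' : 'S_k) :
  order_isomorphic s u -> order_isomorphic s u' -> u = u'.
Proof.
case/andP=> _ /forallP hu /andP[_ /forallP hu'].
apply/permP => a; apply: val_inj; rewrite /= -(card_perm_lt u) -(card_perm_lt u').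
apply: eq_card => b; rewrite !inE.
by rewrite -(eqP (forallP (hu b) a)) -(eqP (forallP (hu' b) a)).
Qed.

(** Standardization: each position is sent to the rank of its entry, and distinct entries have
    distinct ranks. *)
Lemma order_isomorphic_exists (k : nat) (s : seq nat) :
  uniq s -> size s = k -> exists u : 'S_k, order_isomorphic s u.
Proof.
move=> us sk.
pose r (a : 'I_k) := #|[set b : 'I_k | (nth 0%N s b < nth 0%N s a)%N]|.
have rlt (a b : 'I_k) : (nth 0%N s a < nth 0%N s b)%N -> (r a < r b)%N.
  move=> ab; apply: proper_card; apply/properP; split.
    by apply/subsetP => c; rewrite !inE => /ltn_trans; apply.
  by exists a; rewrite inE ?ltnn.
have rk a : (r a < k)%N.
  rewrite -[X in (_ < X)%N](card_ord k) -cardsT; apply: proper_card.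
  by apply/properP; split; [exact: subsetT | exists a; rewrite inE ?ltnn].
have rlt_iff (a b : 'I_k) : ((r a < r b) = (nth 0%N s a < nth 0%N s b))%N.
  apply/idP/idP; last exact: rlt.
  case: (ltngtP (nth 0%N s a) (nth 0%N s b)) => // [/rlt ba /ltn_trans /(_ ba)|E].
    by rewrite ltnn.
  by rewrite /r E ltnn.
pose f a := Ordinal (rk a).
have fi : injective f.
  move=> a b /(congr1 val) /= E; apply/val_inj/eqP.
  rewrite -(@nth_uniq _ 0%N s) ?sk ?ltn_ord //; apply/eqP.
  by case: (ltngtP (nth 0%N s a) (nth 0%N s b)) => // /rlt; rewrite E ltnn.
exists (perm fi); rewrite /order_isomorphic sk eqxx /=.
by apply/forallP => a; apply/forallP => b; rewrite !permE /= rlt_iff.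
Qed.

Lemma occurrence_exists (l d : nat) (v : 'S_d) (S : {set 'I_d}) :
  #|S| = l -> exists w : 'S_l, S \in occurrences w v.
Proof.
move=> cS; have [||w hw] := @order_isomorphic_exists l (subword v S).
- by rewrite map_inj_uniq ?enum_uniq // => i j /val_inj /perm_inj.
- by rewrite size_map -cardE.
- by exists w; rewrite inE cS eqxx.
Qed.

Lemma occurrences_inj (l d : nat) (v : 'S_d) (w w' : 'S_l) (S : {set 'I_d}) :
  S \in occurrences w v -> S \in occurrences w' v -> w = w'.
Proof.
rewrite !inE => /andP[_ hw] /andP[_]; exact: order_isomorphic_inj.
Qed.

(** * Occurrences as tuples of positions, and their projections *)

Definition nth_position (n d : nat) (x0 : 'I_n) (J : {set 'I_n}) :
    {ffun 'I_d -> 'I_n} := [ffun a : 'I_d => nth x0 (enum J) a].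

Lemma nth_position_homo (n d : nat) (x0 : 'I_n) (J : {set 'I_n}) :
  #|J| = d -> {homo nth_position d x0 J : a b / (a < b)%N}.
Proof.
move=> cJ a b ab; rewrite !ffunE.
apply: (@sorted_ltn_nth _ _ _ x0 _ (sorted_enum_set J)) => //.
- by move=> ? ? ?; apply: ltn_trans.
- by rewrite inE -cardE cJ.
- by rewrite inE -cardE cJ.
Qed.

Lemma imset_nth_position (n d : nat) (x0 : 'I_n) (J : {set 'I_n}) :
  #|J| = d -> nth_position d x0 J @: [set: 'I_d] = J.
Proof.
move=> cJ; apply/setP => x; apply/imsetP/idP => [[a _ ->]|xJ].
  by rewrite ffunE -mem_enum mem_nth // -cardE cJ.
have xe : x \in enum J by rewrite mem_enum.
have ix : (index x (enum J) < d)%N by rewrite -cJ cardE index_mem.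
by exists (Ordinal ix); rewrite ?ffunE ?nth_index.
Qed.

(** The position map is strictly increasing, so comparisons in [w] transfer to [v] through [S] and
    then to [pi] through [J]. *)
Lemma occurrences_restrict (n d l : nat) (x0 : 'I_n) (pi : 'S_n) (v : 'S_d)
    (w : 'S_l) (J : {set 'I_n}) (S : {set 'I_d}) :
  J \in occurrences v pi -> S \in occurrences w v ->
  nth_position d x0 J @: S \in occurrences w pi.
Proof.
rewrite !inE => /andP[/eqP cJ /andP[_ /forallP hJ]].
case/andP=> /eqP cS /andP[_ /forallP hS].
have hom := @nth_position_homo _ _ x0 _ cJ.
have inj : injective (nth_position d x0 J).
  move=> a b E; apply/val_inj; case: (ltngtP a b) => // /hom;
  by rewrite E ltnn.
rewrite card_imset // cS eqxx /= /order_isomorphic.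
rewrite /subword enum_imset_mono // !size_map -cardE cS eqxx /=.
apply/forallP => p; apply/forallP => q; rewrite -(eqP (forallP (hS p) q)).
(* The index [p] forces [l] to be positive, which provides a default element for [nth]. *)
have [y0 _] : exists y : 'I_d, y \in S.
  by apply/card_gt0P; rewrite cS; apply: leq_ltn_trans (ltn_ord p).
have szS (r : 'I_l) : (r < size (enum S))%N by rewrite -cardE cS.
rewrite -map_comp !(nth_map y0) //.
rewrite -(eqP (forallP (hJ (nth y0 (enum S) p)) (nth y0 (enum S) q))).
by rewrite /subword !(nth_map x0) -?cardE ?cJ //= !ffunE.
Qed.

Lemma card_coord_proj_occurrences (n d l : nat) (x0 : 'I_n) (pi : 'S_n)
    (v : 'S_d) (w : 'S_l) (S : {set 'I_d}) :
  S \in occurrences w v ->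
  (#|coord_proj x0 S @: (nth_position d x0 @: occurrences v pi)|
     <= Nocc w pi)%N.
Proof.
move=> Sw.
(* [h] rebuilds a projected tuple from its set of kept positions: the coordinate [a] in [S] is the
   entry whose rank is that of [a] in [S]. *)
pose h (J : {set 'I_n}) : {ffun 'I_d -> 'I_n} :=
  [ffun a => if a \in S then nth x0 (enum J) (index a (enum S)) else x0].
apply: leq_trans (leq_imset_card h _); apply: subset_leq_card.
apply/subsetP => _ /imsetP [_ /imsetP [J Jv ->] ->].
apply/imsetP; exists (nth_position d x0 J @: S).
  exact: occurrences_restrict Sw.
have cJ : #|J| = d by move: Jv; rewrite inE => /andP[/eqP].
apply/ffunP => a; rewrite !ffunE; case: ifP => // aS.
rewrite enum_imset_mono; last exact: nth_position_homo.
by rewrite (nth_map a) ?nth_index ?index_mem ?mem_enum // ffunE.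
Qed.

(** Every [l]-subset carries exactly one pattern; grouping by it puts [Nocc w v] factors in the
    class of [w]. *)
Lemma prod_draws_by_pattern (R : realType) (l d : nat) (v : 'S_d)
    (G : 'S_l -> R) (H : {set 'I_d} -> R) :
  (forall S, 0 <= H S) ->
  (forall w S, S \in occurrences w v -> H S <= G w) ->
  \prod_(S in [set S : {set 'I_d} | #|S| == l]) H S <=
  \prod_(w in patterns_in l v) G w ^+ Nocc w v.
Proof.
move=> H0 HG.
pose p (S : {set 'I_d}) : 'S_l :=
  odflt 1%g [pick w : 'S_l | S \in occurrences w v].
have pP (S : {set 'I_d}) : #|S| = l -> S \in occurrences (p S) v.
  rewrite /p => /(@occurrence_exists _ _ v) [w hw].
  by case: pickP => [//|/(_ w)]; rewrite hw.
have pw (w : 'S_l) (S : {set 'I_d}) : ((#|S| == l) && (p S == w)) = (S \in occurrences w v).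
  apply/andP/idP => [[/eqP cS /eqP <-]|Sw]; first exact: pP.
  have cS : #|S| == l by move: Sw; rewrite inE => /andP[].
  by split=> //; apply/eqP; apply: occurrences_inj Sw; apply/pP/eqP.
rewrite (partition_big p (fun w => w \in patterns_in l v)) /=; last first.
  move=> S; rewrite inE => /eqP cS; rewrite inE; apply/set0Pn; exists S.
  exact: pP.
apply: ler_prod => w _; rewrite prodr_ge0 //=.
rewrite (eq_bigl (fun S => S \in occurrences w v)); last first.
  by move=> S; rewrite inE pw.
rewrite /Nocc -prodr_const; apply: ler_prod => S Sw.
by rewrite H0 HG.
Qed.

Theorem theorem1 (R : realType) (n d l : nat) (pi : 'S_n) (v : 'S_d)
    (hl : (1 < l)%N) (hld : (l < d)%N) :
  (Nocc v pi)%:R <=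
  \prod_(w in patterns_in l v)
    (Nocc w pi)%:R `^ ((Nocc w v)%:R / ('C(d - 1, l - 1))%:R) :> R.
Proof.
have [occ0|[J0 J0v]] := set_0Vmem (occurrences v pi).
  by rewrite /Nocc occ0 cards0 prodr_ge0 // => w _; apply: powR_ge0.
(* An occurrence of [v] is nonempty as [d] is positive; it supplies the default position [x0]. *)
have [x0 _] : exists x, x \in J0.
  apply/card_gt0P; move: J0v; rewrite inE => /andP[/eqP -> _].
  exact: leq_trans hld.
set t := 'C(d - 1, l - 1).
have t0 : (0 < t)%N by rewrite bin_gt0 leq_sub2r // ltnW.
have tR : t%:R != 0 :> R by rewrite pnatr_eq0 -lt0n.
(* Raising both sides to the power [t] clears the denominators and leaves natural exponents. *)
rewrite -(@ler_pXn2r _ t) ?nnegrE ?prodr_ge0 //; last first.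
  by move=> w _; apply: powR_ge0.
rewrite -prodrXl.
under eq_bigr => w _ do
  rewrite -[_ ^+ t]powR_mulrn ?powR_ge0 // -powRrM divfK // powR_mulrn //.
pose F := nth_position d x0 @: occurrences v pi.
(* An occurrence is the range of its tuple, so the encoding is injective. *)
have cF : #|F| = Nocc v pi.
  apply: card_in_imset => J J'; rewrite !inE => /andP[/eqP cJ _].
  move=> /andP[/eqP cJ' _] E.
  by rewrite -(@imset_nth_position _ _ x0 _ cJ) E imset_nth_position.
rewrite -cF.
pose Q := [set S : {set 'I_d} | #|S| == l].
apply: (le_trans (@shearer R _ _ _ x0 Q id t F t0 _)).
  move=> i; have -> : t = 'C(#|'I_d| - 1, l - 1) by rewrite card_ord.
  rewrite -(card_draws_mem i (ltnW hl)).
  by apply: eq_card => S; rewrite !inE.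
apply: prod_draws_by_pattern => // w S Sw; rewrite ler_nat.
exact: card_coord_proj_occurrences.
Qed.
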